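(* Assume $W$ is finite. Let $w_0$ be the longest element in $W$. Then \[ b(C_x)H_{w_0}=P_{xw_0} \] for all $x\in W$.
   Context: Let $(W,S)$ be a Coxeter system with length function $\ell\colon W\to\mathbf{Z}_{\geq 0}$ and identity $e$. The Hecke algebra $\mathcal{H}$ is the free $\mathbf{Z}[v,v^{-1}]$-module $\bigoplus_{x\in W}\mathbf{Z}[v,v^{-1}]T_x$ with $\mathbf{Z}[v,v^{-1}]$-algebra structure given by $T_xT_y=T_{xy}$ if $\ell(xy)=\ell(x)+\ell(y)$, and $(T_s+1)(T_s-v^{-2})=0$ for all $s\in S$; the unit is $T_e=1$. Set $H_x=v^{\ell(x)}T_x$ for $x\in W$; each $H_x$ is invertible. Let $d\colon\mathcal{H}\to\mathcal{H}$, $H\mapsto\overline{H}$, be the ring involution with $d(v)=v^{-1}$ and $d(H_x)=H_{x^{-1}}^{-1}$. An element $C\in\mathcal{H}$ is self-dual if $\overline{C}=C$. For each $x\in W$, $C_x$ denotes the Kazhdan-Lusztig basis element: the unique self-dual element of $\mathcal{H}$ such that $C_x\in H_x+\sum_{y\in W}v\mathbf{Z}[v]H_y$. Let $b\colon\mathcal{H}\to\mathcal{H}$ be the ring involution with $b(v)=-v^{-1}$ and $b(H_x)=H_x$ for all $x\in W$. The form $\langle\cdot,\cdot\rangle\colon\mathcal{H}\otimes\mathcal{H}\to\mathbf{Z}[v,v^{-1}]$ is the symmetric $\mathbf{Z}[v,v^{-1}]$-bilinear form with $\langle H_x,H_y\rangle=\delta_{x,y}$ for $x,y\in W$. When $W$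 is finite, for each $x\in W$, $P_x$ denotes the unique element of $\mathcal{H}$ such that $\langle P_x,C_y\rangle=\delta_{x,y}$ for all $y\in W$. *)

(* Defs.v *)
From HB Require Import structures.
From mathcomp Require Import all_boot all_order all_algebra all_fingroup.
From mathcomp Require Import boolp.

Set Implicit Arguments.
Unset Strict Implicit.
Unset Printing Implicit Defensive.

Import GRing.Theory.
Local Open Scope ring_scope.

(* Z[v, v^-1], as the subring of Q(v) = Frac Z[v] of the fractions x such that
   v^n x lies in Z[v] for some n. *)
Definition laurent_pred : {pred {fraction {poly int}}} :=
  fun x => `[< exists n (p : {poly int}), tofrac 'X ^+ n * x = tofrac p >].

Fact laurent_subring : subring_closed laurent_pred.
Proof.
split.
- by apply/asboolP; exists 0%N, 1; rewrite expr0 mulr1 tofrac1.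
- move=> x y /asboolP[n [p xE]] /asboolP[m [q yE]]; apply/asboolP.
  exists (n + m)%N, ('X^m * p - 'X^n * q).
  rewrite tofracB !tofracM !tofracXn -xE -yE exprD mulrBr !mulrA.
  by rewrite [_ ^+ m * _]mulrC.
- move=> x y /asboolP[n [p xE]] /asboolP[m [q yE]]; apply/asboolP.
  by exists (n + m)%N, (p * q); rewrite tofracM -xE -yE exprD mulrACA.
Qed.

HB.instance Definition _ :=
  GRing.isSubringClosed.Build _ laurent_pred laurent_subring.

Record laurent :=
  Laurent { laurent_val : {fraction {poly int}}; _ : laurent_val \in laurent_pred }.

HB.instance Definition _ := [isSub for laurent_val].
HB.instance Definition _ := [Choice of laurent by <:].
HB.instance Definition _ := [SubChoice_isSubComNzRing of laurent by <:].

Fact v_subproof : tofrac 'X \in laurent_pred.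
Proof. by apply/asboolP; exists 0%N, 'X; rewrite expr0 mul1r. Qed.

Fact vinv_subproof : (tofrac 'X)^-1 \in laurent_pred.
Proof.
apply/asboolP; exists 1%N, 1.
by rewrite expr1 tofrac1 divff // tofrac_eq0 polyX_eq0.
Qed.

Definition v : laurent := Laurent v_subproof.
Definition vinv : laurent := Laurent vinv_subproof.

Lemma v_vinv : v * vinv = 1.
Proof. by apply/val_inj; rewrite /= divff // tofrac_eq0 polyX_eq0. Qed.

(* the inclusion of Z[v] in Z[v, v^-1] *)
Definition of_Zv (p : {poly int}) : laurent := (map_poly intr p).[v].

Section Coxeter.
Variables (W : finGroupType) (S : {set W}).

(* The last clause is the universal property of the presentation of W by the
   generators S and the relations (st)^m(s,t) = 1, where m(s,t) is the order of
   st in W (so m(s,s) = 1); uniqueness of phi follows from the second clause. *)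
Definition coxeter_system : Prop :=
  [/\ {in S, forall s, #[s]%g = 2%N},
      <<S>>%g = [set: W] &
      forall (G : groupType) (f : W -> G),
        {in S &, forall s t, ((f s * f t) ^+ #[(s * t)%g] = 1)%g} ->
        exists phi : {multiplicative W -> G}, {in S, phi =1 f}].

(* the least k such that x is a product of k elements of S, and the junk value
   0 if there is none, which does not happen in a Coxeter system *)
Definition cox_length (x : W) : nat :=
  if pselect (exists k, x \in (S ^+ k)%g) is left ex_k then ex_minn ex_k else 0%N.

Definition longest (w : W) : Prop := forall x, (cox_length x <= cox_length w)%N.

Variables (H : algType laurent) (T : W -> H).

Definition hecke_algebra : Prop :=
  [/\ forall h : H, exists! a : {ffun W -> laurent}, h = \sum_x a x *: T x,
      T 1%g = 1,
      forall x y, cox_length (x * y)%g = (cox_length x + cox_length y)%N ->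
        T x * T y = T (x * y)%g &
      {in S, forall s, (T s + 1) * (T s - (vinv ^+ 2)%:A) = 0}].

Definition Hstd (x : W) : H := v ^+ cox_length x *: T x.

Definition inverse_of (h h' : H) : Prop := h * h' = 1 /\ h' * h = 1.

Definition duality (d : {rmorphism H -> H}) : Prop :=
  [/\ involutive d, d v%:A = vinv%:A &
      forall x, inverse_of (Hstd x^-1%g) (d (Hstd x))].

Definition b_involution (b : {rmorphism H -> H}) : Prop :=
  [/\ involutive b, b v%:A = (- vinv)%:A & forall x, b (Hstd x) = Hstd x].

Definition kazhdan_lusztig (d : H -> H) (x : W) (c : H) : Prop :=
  d c = c /\
  exists q : W -> {poly int}, c = Hstd x + \sum_y (v * of_Zv (q y)) *: Hstd y.

Definition standard_form (form : H -> H -> laurent) : Prop :=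
  [/\ forall h, scalar (form h),
      forall h h', form h h' = form h' h &
      forall x y, form (Hstd x) (Hstd y) = (x == y)%:R].

End Coxeter.

(* Main.v *)
Require Import Defs.
From mathcomp Require Import all_boot all_order all_algebra all_fingroup.
From mathcomp Require Import boolp.

Set Implicit Arguments.
Unset Strict Implicit.

Import GRing.Theory.
Local Open Scope ring_scope.

(** The values of the form against all the C_y determine an element of the
    Hecke algebra [dual_family_unique], so the theorem says that g = <b(C_x) H_w0, C_y> is 1 if
    x w0 = y and 0 otherwise.  Write C_x = sum_z p_z(v) H_z and
    C_y = sum_u r_u(v) H_u with p_z, r_u in Z[v], whose constant terms are
    those of H_x and H_y.  The involutions b and d commute, so b(C_x) is
    self-dual like C_y; hence each of them has one expansion on the H_z and
    another on the inverses d(H_z) of the H_{z^-1}: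
      b(C_x) = sum_z p_z(-v^-1) H_z = sum_z p_z(-v) d(H_z),
      C_y    = sum_u r_u(v) H_u     = sum_u r_u(v^-1) d(H_u).
    Two facts about w0 evaluate the form on mixed pairs: d(H_u) H_w0 = H_{u w0}
    [d_Hstd_longest], and right multiplication by H_w0 is self-adjoint
    [form_mul_longest].  Pairing the first expansion of b(C_x) with the second
    one of C_y gives g = G(v^-1), and pairing the second one with the first one
    gives g = G(v), for the same polynomial
      G = sum_u p_{u w0}(-X) r_u(X).
    A polynomial with G(v) = G(v^-1) is constant [zeval_bar_invariant], so g is
    the sum of the products of the constant terms, which is as wanted
    [kazhdan_lusztig_pairing].

    The identity d(H_u) H_w0 = H_{u w0} rests on
    l(w0 u^-1) + l(u) = l(w0) [len_longest].  Instead of the exchange condition,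
    its proof uses the algebra: H_w0 H_t has a nonzero coefficient at H_w0 for
    every simple t, whereas the coefficients of H_a H_y live on the z with
    l(z y^-1) <= l(a) [Hstd_support].  The presentation of W only serves to show
    that multiplication by a simple reflection changes the length
    [len_parity]. *)

(** * Values of integral polynomials in Laurent polynomials *)

Definition zeval (R : comNzRingType) (r : R) (p : {poly int}) : R :=
  (map_poly intr p).[r].
Arguments zeval {R} r p.

Lemma zeval_map (R R' : comNzRingType) (f : {rmorphism R -> R'}) r p :
  f (zeval r p) = zeval (f r) p.
Proof.
rewrite /zeval -horner_map -map_poly_comp; congr (_.[_]).
by apply: eq_map_poly => a /=; rewrite rmorph_int.
Qed.

Lemma zevalM (R : comNzRingType) (r : R) p q :
  zeval r (p * q) = zeval r p * zeval r q.
Proof. by rewrite /zeval rmorphM hornerM. Qed.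

Lemma zeval_sum (R : comNzRingType) (r : R) I (s : seq I) (F : I -> {poly int}) :
  zeval r (\sum_(i <- s) F i) = \sum_(i <- s) zeval r (F i).
Proof. by rewrite /zeval rmorph_sum horner_sum. Qed.

Lemma zeval_compN (R : comNzRingType) (r : R) p :
  zeval r (p \Po (- 'X)) = zeval (- r) p.
Proof. by rewrite /zeval map_comp_poly horner_comp rmorphN /= map_polyX !hornerE. Qed.

Lemma zevalXn (R : comNzRingType) (r : R) n : zeval r 'X^n = r ^+ n.
Proof. by rewrite /zeval map_polyXn hornerXn. Qed.

Lemma zevalX (R : comNzRingType) (r : R) : zeval r 'X = r.
Proof. by rewrite /zeval map_polyX hornerX. Qed.

Lemma zevalC (R : comNzRingType) (r : R) a : zeval r a%:P = a%:~R.
Proof. by rewrite /zeval map_polyC hornerC. Qed.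

Lemma zevalE (R : comNzRingType) (r : R) p :
  zeval r p = \sum_(i < size p) (p`_i)%:~R * r ^+ i.
Proof.
rewrite -{1}[p]coefK poly_def zeval_sum; apply: eq_bigr => i _.
by rewrite -mul_polyC zevalM zevalC zevalXn.
Qed.

Lemma tofrac_zeval p : tofrac p = zeval (tofrac 'X) p.
Proof.
rewrite zevalE -{1}[p]coefK poly_def rmorph_sum; apply: eq_bigr => i _ /=.
by rewrite -mul_polyC rmorphM /= rmorphXn -[p`_i in LHS]intz !rmorph_int.
Qed.

(** Z[v] embeds in Z[v, v^-1], because the latter lies in the fraction field
    of Z[v]. *)
Lemma zeval_v_inj : injective (zeval v).
Proof.
move=> p q /(congr1 \val); rewrite !zeval_map /= -!tofrac_zeval.
by move/eqP; rewrite tofrac_eq => /eqP.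
Qed.

(** The reversal of p: the factor v^(size p) clears all the negative powers of
    v, and even leaves a positive power of v in every term. *)
Lemma zeval_vinv_shift (p : {poly int}) :
  v ^+ size p * zeval vinv p =
  zeval v (\sum_(i < size p) (p`_i)%:P * 'X^(size p - i)).
Proof.
rewrite zevalE big_distrr zeval_sum /=; apply: eq_bigr => i _.
rewrite zevalM zevalC zevalXn mulrCA; congr (_ * _).
rewrite -{1}(subnK (ltnW (ltn_ord i))) exprD -mulrA -exprMn v_vinv expr1n.
by rewrite mulr1.
Qed.

(** The uniqueness principle behind the Kazhdan-Lusztig basis: p(v) has no
    negative power of v and p(v^-1) has no positive one. *)
Lemma zeval_bar_invariant (p : {poly int}) :
  zeval v p = zeval vinv p -> p = (p`_0)%:P.
Proof.
move=> bar_p; apply/polyP => j; rewrite coefC; case: j => [|j] //=.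
have: 'X^(size p) * p = \sum_(i < size p) (p`_i)%:P * 'X^(size p - i).
  apply: zeval_v_inj; rewrite -zeval_vinv_shift zevalM bar_p.
  by rewrite zevalXn.
(* All the terms of the reversal of p have degree at most size p. *)
move/(congr1 (fun q : {poly int} => q`_(size p + j.+1))).
rewrite coefXnM ltnNge leq_addr /= addKn => ->.
rewrite coef_sum big1 // => i _; rewrite coefCM coefXn.
by rewrite gtn_eqF ?mulr0 // addnS ltnS (leq_trans (leq_subr _ _)) ?leq_addr.
Qed.

Lemma v_neq_vinv : vinv - v != 0.
Proof.
apply/eqP => /eqP; rewrite subr_eq0 => /eqP vv.
have /zeval_bar_invariant : zeval v 'X = zeval vinv 'X by rewrite !zevalX.
by move/(congr1 (fun p : {poly int} => p`_1)); rewrite coefX coefC.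
Qed.

(** * Lengths in a Coxeter system *)

Section Length.
Variables (W : finGroupType) (S : {set W}).
Hypothesis coxS : coxeter_system S.
Local Open Scope group_scope.
Local Notation len := (cox_length S).

Lemma mem_gen_expg x : exists k, x \in S ^+ k.
Proof.
have [_ genS _] := coxS.
have /gen_prodgP[n [c Sc ->]] : x \in <<S>> by rewrite genS inE.
exists n; elim: n c Sc => [|n IHn] c Sc; first by rewrite big_ord0 expg0 set11.
by rewrite big_ord_recl expgS mem_mulg // IHn.
Qed.

(** Every element is a product of generators, so the junk value in the
    definition of the length is never taken. *)
Lemma cox_lengthP x :
  x \in S ^+ len x /\ forall k, x \in S ^+ k -> (len x <= k)%N.
Proof.
rewrite /cox_length; case: pselect => [ex_k|[]]; last exact: mem_gen_expg.
by case: ex_minnP.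
Qed.

Lemma len1 : len 1 = 0%N.
Proof. by apply/eqP; rewrite -leqn0 (cox_lengthP 1).2 // expg0 set11. Qed.

Lemma len_eq0 x : len x = 0%N -> x = 1.
Proof. by move=> lx; have [+ _] := cox_lengthP x; rewrite lx expg0 => /set1P. Qed.

Lemma lenM x y : (len (x * y) <= len x + len y)%N.
Proof.
by apply: (cox_lengthP _).2; rewrite expgnDr mem_mulg ?(cox_lengthP _).1.
Qed.

Lemma gen_invol s : s \in S -> s * s = 1.
Proof.
by have [S2 _ _] := coxS; move=> /S2 os; rewrite -expg2 -os expg_order.
Qed.

Lemma gen_invg s : s \in S -> s^-1 = s.
Proof. by move=> Ss; apply/eqP; rewrite eq_invg_mul gen_invol. Qed.

Lemma len_gen s : s \in S -> len s = 1%N.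
Proof.
move=> Ss; apply/eqP; rewrite eqn_leq (cox_lengthP s).2 ?expg1 //= lt0n.
apply: contraTneq Ss => /len_eq0 ->; apply/negP => S1.
by have [/(_ _ S1)] := coxS; rewrite order1.
Qed.

Lemma lenV x : len x^-1 = len x.
Proof.
have leV y : (len y^-1 <= len y)%N.
  apply: (cox_lengthP _).2; have [+ _] := cox_lengthP y.
  move: (len y) => n; elim: n y => [|k IHk] y.
    by rewrite expg0 => /set1P->; rewrite invg1 set11.
  rewrite expgS => /mulsgP[s z Ss /IHk Sz ->].
  by rewrite -expgS expgSr invMg mem_mulg // gen_invg.
by apply/eqP; rewrite eqn_leq leV -{1}[x]invgK leV.
Qed.

Lemma last_letter x : (0 < len x)%N ->
  exists y s, [/\ s \in S, x = y * s & len x = (len y).+1].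
Proof.
move=> lx; have [] := cox_lengthP x; rewrite -{1}(prednK lx) expgSr.
case/mulsgP=> y s Sy Ss xE _; exists y, s; split=> //.
apply/eqP; rewrite eqn_leq -{2}(prednK lx) ltnS (cox_lengthP y).2 // andbT.
by rewrite xE -addn1 -(len_gen Ss) lenM.
Qed.

Lemma cox_ind (Q : W -> Prop) : Q 1 ->
  (forall y s, s \in S -> len (y * s) = (len y).+1 -> Q y -> Q (y * s)) ->
  forall x, Q x.
Proof.
move=> Q1 QS x; have [k] := ubnP (len x); elim: k x => // k IHk x.
rewrite ltnS => lxk; have [/len_eq0-> //|lx] := posnP (len x).
have [y [s [Ss xE lxE]]] := last_letter lx.
by rewrite xE; apply: QS; rewrite -?xE //; apply: IHk; rewrite -lxE.
Qed.

(** The presentation of W enters here: its relations are even, so that sending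
    every generator to the transposition of bool defines a sign morphism, and
    the sign of an element is the parity of its length. *)
Lemma len_parity x s y : s \in S -> len (x * s * y) != len (x * y).
Proof.
move=> Ss; pose t : {perm bool} := tperm true false.
have [_ _ /(_ {perm bool} (fun=> t))[|phi phiS]] := coxS.
  by move=> *; rewrite tperm2 expg1n.
have phi1 : phi 1 = 1 by apply: (@mulgI _ (phi 1)); rewrite -gmulfM !mulg1.
have phiE z : phi z = t ^+ len z.
  have [+ _] := cox_lengthP z; move: (len z) => n; elim: n z => [|k IHk] z.
    by rewrite !expg0 => /set1P->; rewrite phi1.
  by rewrite !expgS => /mulsgP[u z' Su /IHk <- ->]; rewrite gmulfM phiS.
apply: contraTneq isT => eq_len.
have: phi (x * s * y) = phi (x * y) by rewrite !phiE eq_len.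
rewrite !gmulfM (phiS _ Ss) => /mulIg; rewrite -[RHS]mulg1 => /mulgI.
by move/(congr1 (fun p : {perm bool} => p true)); rewrite tpermL perm1.
Qed.

Lemma len_mulS x s : s \in S ->
  len (x * s) = (len x).+1 \/ len x = (len (x * s)).+1.
Proof.
move=> Ss; have := len_parity x 1 Ss; rewrite !mulg1 neq_ltn.
have le1 := lenM x s; rewrite (len_gen Ss) addn1 in le1.
have le2 := lenM (x * s) s.
rewrite (len_gen Ss) addn1 -mulgA (gen_invol Ss) mulg1 in le2.
case/orP=> lt; [right|left]; apply/eqP; first by rewrite eqn_leq le2.
by rewrite eqn_leq le1.
Qed.

End Length.

(** * Standard basis and standard form of the Hecke algebra *)

Section Hecke.
Variables (W : finGroupType) (S : {set W}) (H : algType laurent) (T : W -> H).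
Hypotheses (coxS : coxeter_system S) (heckeT : hecke_algebra S T).
Local Notation len := (cox_length S).
Local Notation Hs := (Hstd S T).

Lemma Hstd1 : Hs 1%g = 1.
Proof. by have [_ T1 _ _] := heckeT; rewrite /Hstd len1 // scale1r. Qed.

Lemma HstdM x y : len (x * y)%g = (len x + len y)%N -> Hs x * Hs y = Hs (x * y)%g.
Proof.
have [_ _ TM _] := heckeT => lxy.
by rewrite /Hstd -scalerAl -scalerAr scalerA -exprD TM // lxy.
Qed.

Lemma Hstd_sqr s : s \in S -> Hs s * Hs s = 1 + (vinv - v) *: Hs s.
Proof.
move=> Ss; have [_ _ _ /(_ s Ss)] := heckeT.
rewrite mulrDl mul1r mulrBr -scalerAr mulr1 addrA => quad.
have TT : T s * T s = (vinv ^+ 2 - 1) *: T s + vinv ^+ 2 *: 1.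
  by apply/eqP; rewrite -subr_eq0 scalerBl scale1r !opprD opprK !addrA quad.
have vv : v ^+ 2 * vinv ^+ 2 = 1 by rewrite -exprMn v_vinv expr1n.
rewrite /Hstd (len_gen coxS Ss) expr1 -scalerAl -scalerAr !scalerA TT -[v * v]expr2.
rewrite scalerDr !scalerA mulrBr vv scale1r addrC mulr1.
by rewrite mulrBl [vinv * v]mulrC v_vinv.
Qed.

(** When l(x s) < l(x), the element H_x is itself H_{x s} H_s, and the
    quadratic relation applies. *)
Lemma HstdS x s : s \in S ->
  Hs x * Hs s = Hs (x * s)%g + (if (len (x * s) < len x)%N then (vinv - v) *: Hs x else 0).
Proof.
move=> Ss; have [lxs|lx] := len_mulS coxS x Ss.
  by rewrite lxs ltnNge leqnSn addr0 HstdM // lxs (len_gen coxS Ss) addn1.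
rewrite lx ltnSn; set y := (x * s)%g in lx *.
have xE : x = (y * s)%g by rewrite /y -mulgA (gen_invol coxS Ss) mulg1.
have HxE : Hs x = Hs y * Hs s.
  by rewrite xE HstdM // -xE lx (len_gen coxS Ss) addn1.
by rewrite HxE -mulrA Hstd_sqr // mulrDr mulr1 -scalerAr.
Qed.

Lemma Hstd_mulSl s x : s \in S ->
  exists c, Hs s * Hs x = Hs (s * x)%g + c *: Hs x.
Proof.
move=> Ss; have := len_mulS coxS x^-1 Ss.
rewrite -{1 2}(gen_invg coxS Ss) -invMg !(lenV coxS) => -[lsx|lx].
  by exists 0; rewrite scale0r addr0 HstdM // lsx (len_gen coxS Ss).
exists (vinv - v); set y := (s * x)%g in lx *.
have xE : x = (s * y)%g by rewrite /y mulgA (gen_invol coxS Ss) mul1g.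
have HxE : Hs x = Hs s * Hs y.
  by rewrite xE HstdM // -xE lx (len_gen coxS Ss).
by rewrite HxE mulrA Hstd_sqr // mulrDl mul1r -scalerAl.
Qed.

Lemma Hstd_span h : exists a : W -> laurent, h = \sum_x a x *: Hs x.
Proof.
have [/(_ h)[a [-> _]] _ _ _] := heckeT.
exists (fun x => a x * vinv ^+ len x); apply: eq_bigr => x _.
by rewrite scalerA -mulrA -exprMn [vinv * v]mulrC v_vinv expr1n mulr1.
Qed.

Variable form : H -> H -> laurent.
Hypothesis formP : standard_form S T form.

Lemma form_linear h a k l : form h (a *: k + l) = a * form h k + form h l.
Proof. by have [lin _ _] := formP; apply: lin. Qed.

Lemma form_sym h k : form h k = form k h.
Proof. by have [_ sym _] := formP. Qed.

Lemma form_addr h k l : form h (k + l) = form h k + form h l.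
Proof. by rewrite -{1}[k]scale1r form_linear mul1r. Qed.

Lemma form_0r h : form h 0 = 0.
Proof. by have := form_addr h 0 0; rewrite addr0 -{1}[form h 0]addr0 => /addrI. Qed.

Lemma form_scaler h a k : form h (a *: k) = a * form h k.
Proof. by rewrite -[a *: k]addr0 form_linear form_0r addr0. Qed.

Lemma form_sumr h I (s : seq I) (F : I -> H) :
  form h (\sum_(i <- s) F i) = \sum_(i <- s) form h (F i).
Proof. exact: (big_morph _ (form_addr h) (form_0r h)). Qed.

Lemma form_addl h k l : form (h + k) l = form h l + form k l.
Proof. by rewrite !(form_sym _ l) form_addr. Qed.

Lemma form_scalel h a k : form (a *: h) k = a * form h k.
Proof. by rewrite !(form_sym _ k) form_scaler. Qed.

Lemma form_suml h I (s : seq I) (F : I -> H) :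
  form (\sum_(i <- s) F i) h = \sum_(i <- s) form (F i) h.
Proof. by rewrite form_sym form_sumr; apply: eq_bigr => i _; rewrite form_sym. Qed.

Lemma form_Hstd x y : form (Hs x) (Hs y) = (x == y)%:R.
Proof. by have [_ _ ->] := formP. Qed.

Lemma sum_delta (F : W -> laurent) x : \sum_y F y * (y == x)%:R = F x.
Proof.
rewrite (bigD1 x) //= eqxx mulr1 big1 ?addr0 // => y /negPf->.
by rewrite mulr0.
Qed.

Lemma form_coord h : h = \sum_x form h (Hs x) *: Hs x.
Proof.
have [a ->] := Hstd_span h; apply: eq_bigr => x _; congr (_ *: _).
rewrite form_suml -[LHS](sum_delta a).
by apply: eq_bigr => y _; rewrite form_scalel form_Hstd.
Qed.

Lemma form_parseval h k : form h k = \sum_x form h (Hs x) * form (Hs x) k.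
Proof.
rewrite {1}[h]form_coord form_suml.
by apply: eq_bigr => x _; rewrite form_scalel.
Qed.

Lemma form_HstdS x s y : s \in S ->
  form (Hs x * Hs s) (Hs y) =
  (x * s == y)%g%:R + (if (len (x * s) < len x)%N then vinv - v else 0) * (x == y)%:R.
Proof.
move=> Ss; rewrite HstdS // form_addl form_Hstd; case: ifP => _.
  by rewrite form_scalel form_Hstd.
by rewrite form_sym form_0r mul0r.
Qed.

(** On basis elements, both sides are given by [form_HstdS], which is symmetric
    in x and y because s is an involution. *)
Lemma form_adjointS h k s : s \in S -> form (h * Hs s) k = form h (k * Hs s).
Proof.
move=> Ss; have base x y : form (Hs x * Hs s) (Hs y) = form (Hs x) (Hs y * Hs s).
  rewrite [RHS]form_sym !form_HstdS // [x == y]eq_sym; congr (_%:R + _).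
    by rewrite -(inj_eq (mulIg s)) -mulgA (gen_invol coxS Ss) mulg1 eq_sym.
  by case: eqP => [->|] //; rewrite !mulr0.
rewrite [h]form_coord [k]form_coord !mulr_suml !form_suml.
apply: eq_bigr => x _; rewrite !form_sumr; apply: eq_bigr => y _.
(* The standard basis is generalized away, since each H_x is itself a
   multiple of T_x, from which the scalar would also be extracted. *)
move: (Hs x) (Hs y) (base x y) => hx hy base_xy.
by rewrite -!scalerAl !form_scalel !form_scaler base_xy.
Qed.

Lemma form_adjoint h k x : form (h * Hs x) k = form h (k * Hs x^-1%g).
Proof.
elim/(cox_ind coxS): x h k => [|y s Ss lys IHy] h k.
  by rewrite invg1 Hstd1 !mulr1.
have ls := len_gen coxS Ss.
rewrite -HstdM ?ls ?addn1 // mulrA form_adjointS // IHy -mulrA HstdM.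
  by rewrite invMg (gen_invg coxS Ss).
by rewrite -{1}(gen_invg coxS Ss) -invMg !(lenV coxS) ls lys.
Qed.

(** Multiplying by H_a on the left amounts to multiplying by the letters of a
    reduced word of a one at a time, and each letter is either applied or
    dropped: only elements a' y with a' of length at most l(a) can occur. *)
Lemma Hstd_support a y z :
  form (Hs a * Hs y) (Hs z) != 0 -> (len (z * y^-1)%g <= len a)%N.
Proof.
elim/(cox_ind coxS): a y => [|a s Ss las IHa] y.
  rewrite Hstd1 mul1r form_Hstd; have [<- _|] := eqVneq y z.
    by rewrite mulgV len1.
  by rewrite eqxx.
have ls := len_gen coxS Ss.
rewrite -HstdM ?ls ?addn1 // -mulrA.
have [c ->] := Hstd_mulSl y Ss.
rewrite mulrDr -(scalerAr c) form_addl (form_scalel (Hs a * Hs y)) las => nz.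
have [nz1|] := boolP (form (Hs a * Hs (s * y)%g) (Hs z) != 0).
  have := IHa _ nz1; rewrite invMg (gen_invg coxS Ss) mulgA => le_a.
  have := lenM coxS (z * y^-1 * s)%g s.
  rewrite -[(_ * s * s)%g]mulgA (gen_invol coxS Ss) mulg1 ls addn1.
  by move/leq_trans; apply.
rewrite negbK => /eqP z1; rewrite z1 add0r in nz.
by apply/leqW/IHa; apply: contraNneq nz => ->; rewrite mulr0.
Qed.

(** By induction on l(u).  If w0 = a u with additive lengths and t is a simple
    reflection with l(u t) > l(u), then H_a H_{u t} = H_w0 H_t involves H_w0,
    since l(w0 t) < l(w0).  So [Hstd_support] bounds the length of
    w0 (u t)^-1 by l(a), and parity makes the inequality strict. *)
Lemma len_longest w0 : longest S w0 ->
  forall u, (len (w0 * u^-1)%g + len u)%N = len w0.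
Proof.
move=> max_w0; elim/(cox_ind coxS) => [|u t St lut IHu].
  by rewrite invg1 mulg1 len1 ?addn0.
have absorb : form (Hs (w0 * u^-1)%g * Hs (u * t)%g) (Hs w0) != 0.
  rewrite -(@HstdM u t) ?lut ?(len_gen coxS St) ?addn1 // mulrA HstdM mulgKV ?IHu //.
  rewrite form_HstdS // eqxx mulr1.
  have [lw0t|lw0] := len_mulS coxS w0 St.
    by have := max_w0 (w0 * t)%g; rewrite lw0t ltnn.
  have /negPf-> : (w0 * t)%g != w0.
    by apply: contra_eq_neq lw0 => ->; rewrite neq_ltn ltnSn.
  by rewrite lw0 ltnSn add0r v_neq_vinv.
have le_ut := Hstd_support absorb.
have neq_ut := len_parity coxS w0 u^-1 St.
have sub := lenM coxS (w0 * (u * t)^-1)%g (u * t)%g.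
rewrite mulgKV in sub; apply/eqP; rewrite eqn_leq sub andbT lut addnS -IHu.
rewrite -addSn leq_add2r ltn_neqAle le_ut andbT.
by rewrite invMg (gen_invg coxS St) mulgA.
Qed.

Lemma longest_invol w0 : longest S w0 -> (w0 * w0)%g = 1%g.
Proof.
move=> max_w0; have := len_longest max_w0 w0^-1%g.
rewrite invgK (lenV coxS) -[RHS]add0n => /addIn.
exact: (len_eq0 coxS).
Qed.

Lemma Hstd_longest w0 u : longest S w0 -> Hs u^-1%g * Hs (u * w0)%g = Hs w0.
Proof.
move=> max_w0; rewrite HstdM mulKg //.
have w0V : w0^-1%g = w0 by apply/eqP; rewrite eq_invg_mul (longest_invol max_w0).
by rewrite -(len_longest max_w0 u) addnC -(lenV coxS (w0 * _)) invMg invgK w0V (lenV coxS).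
Qed.

(** As W is finite, a family dual to C has a square coordinate matrix, which is
    a left inverse, hence the two-sided inverse, of the transposed coordinate
    matrix of C. *)
Lemma dual_family_unique (C P P' : W -> H) :
  (forall x y, form (P x) (C y) = (x == y)%:R) ->
  (forall x y, form (P' x) (C y) = (x == y)%:R) -> P =1 P'.
Proof.
move=> dualP dualP'.
pose coords (Q : W -> H) : 'M[laurent]_#|W| :=
  \matrix_(i, j) form (Q (enum_val i)) (Hs (enum_val j)).
have coordsM Q : (forall x y, form (Q x) (C y) = (x == y)%:R) ->
  coords Q *m (coords C)^T = 1%:M.
  move=> dualQ; apply/matrixP => i j; rewrite !mxE.
  rewrite -(inj_eq enum_val_inj) -dualQ form_parseval.
  rewrite [RHS](reindex _ (onW_bij _ (enum_val_bij W))) /=.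
  by apply: eq_bigr => k _; rewrite !mxE [form (C _) _]form_sym.
have eqPP' : coords P = coords P'.
  by rewrite -[LHS]mulmx1 -(mulmx1C (coordsM _ dualP')) mulmxA coordsM // mul1mx.
move=> x; rewrite [LHS]form_coord [RHS]form_coord.
apply: eq_bigr => y _; congr (_ *: _).
move/matrixP: eqPP' => /(_ (enum_rank x) (enum_rank y)).
by rewrite !mxE !enum_rankK.
Qed.

End Hecke.

(** * Kazhdan-Lusztig elements and the longest element *)

(** A ring morphism fixes the integers, so its effect on the scalars of Z[r] is
    determined by its effect on r.  This covers d and b, with r equal to v or
    to v^-1. *)
Lemma rmorph_zevalZ (H : algType laurent) (f : {rmorphism H -> H}) r r' p h :
  f r%:A = r'%:A -> f (zeval r p *: h) = zeval r' p *: f h.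
Proof.
move=> fr; rewrite -mulr_algl rmorphM /= -[RHS]mulr_algl; congr (_ * _).
rewrite -[LHS]/((f \o in_alg H) (zeval r p)) -[RHS]/(in_alg H (zeval r' p)).
rewrite !zevalE !rmorph_sum; apply: eq_bigr => i _.
by rewrite !rmorphM !rmorphXn !rmorph_int; congr (_ * _ ^+ _).
Qed.

Section DualBases.
Variables (W : finGroupType) (S : {set W}) (H : algType laurent) (T : W -> H).
Hypotheses (coxS : coxeter_system S) (heckeT : hecke_algebra S T).
Variables (d b : {rmorphism H -> H}) (form : H -> H -> laurent) (w0 : W).
Hypotheses (dP : duality S T d) (bP : b_involution S T b).
Hypotheses (formP : standard_form S T form) (max_w0 : longest S w0).
Local Notation Hs := (Hstd S T).

(** The leading term H_x is absorbed into the sum, so that unitriangularity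
    becomes a condition on constant terms. *)
Lemma kazhdan_lusztig_coef x c : kazhdan_lusztig S T d x c ->
  exists p : W -> {poly int},
    c = \sum_z zeval v (p z) *: Hs z /\ forall z, (p z)`_0 = (z == x)%:R.
Proof.
case=> _ [q ->]; exists (fun z => (z == x)%:R%:P + 'X * q z); split=> [|z].
  rewrite -{1}[Hs x](big_pred1_eq +%R x Hs) big_mkcond -big_split /=.
  apply: eq_bigr => z _.
  rewrite /zeval rmorphD rmorphM /= map_polyC map_polyX !hornerE /=.
  by rewrite -/(of_Zv (q z)) scalerDl; case: eqP; rewrite ?scale1r ?scale0r.
by rewrite coefD coefC coefXM addr0.
Qed.

Lemma b_vinv : b vinv%:A = (- v)%:A.
Proof.
have [bK bv _] := bP.
by rewrite -[vinv]opprK scaleNr rmorphN -bv bK scaleNr.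
Qed.

Lemma d_Hstd_longest u : d (Hs u) * Hs w0 = Hs (u * w0)%g.
Proof.
have [_ _ /(_ u)[_ dHK]] := dP.
by rewrite -(Hstd_longest coxS heckeT formP u max_w0) mulrA dHK mul1r.
Qed.

(** Both d(H_u) and its image by b are inverse to the b-invariant element
    H_{u^-1}. *)
Lemma b_d_Hstd u : b (d (Hs u)) = d (Hs u).
Proof.
have [_ _ /(_ u)[Hd dH]] := dP; have [_ _ bH] := bP.
by rewrite -[LHS]mulr1 -Hd mulrA -[Hs u^-1%g]bH -rmorphM dH rmorph1 mul1r.
Qed.

Lemma form_mul_longest h k : form (h * Hs w0) k = form h (k * Hs w0).
Proof.
rewrite (form_adjoint coxS heckeT formP); congr (form h (k * Hs _)).
by apply/eqP; rewrite eq_invg_mul (longest_invol coxS heckeT formP max_w0).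
Qed.

(** Computing the pairing with b(c) expanded on the H_z and c' on the d(H_u),
    then the other way round, yields the values at v^-1 and at v of one and the
    same polynomial. *)
Lemma kazhdan_lusztig_pairing x y c c' :
  kazhdan_lusztig S T d x c -> kazhdan_lusztig S T d y c' ->
  form (b c * Hs w0) c' = ((x * w0)%g == y)%:R.
Proof.
move=> KLc KLc'; have [dc _] := KLc; have [dc' _] := KLc'.
have [p [cE p0]] := kazhdan_lusztig_coef KLc.
have [r [c'E r0]] := kazhdan_lusztig_coef KLc'.
have [dK dv dH] := dP; have [bK bv bH] := bP.
have w0K : involutive (fun z => z * w0)%g.
  by move=> z; rewrite -mulgA (longest_invol coxS heckeT formP max_w0) mulg1.
have bcE : b c = \sum_z zeval (- vinv) (p z) *: Hs z.
  rewrite cE rmorph_sum; apply: eq_bigr => z _ /=.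
  by rewrite (rmorph_zevalZ _ _ bv) bH.
have bcE' : b c = \sum_z zeval (- v) (p z) *: d (Hs z).
  rewrite -dc cE !rmorph_sum; apply: eq_bigr => z _ /=.
  by rewrite (rmorph_zevalZ _ _ dv) (rmorph_zevalZ _ _ b_vinv) b_d_Hstd.
have c'E' : c' = \sum_u zeval vinv (r u) *: d (Hs u).
  rewrite -dc' c'E rmorph_sum; apply: eq_bigr => u _ /=.
  by rewrite (rmorph_zevalZ _ _ dv).
(* The pairing is the value of G both at v^-1 and at v. *)
pose G : {poly int} := \sum_u (p (u * w0)%g \Po (- 'X)) * r u.
have GE (t : laurent) :
    zeval t G = \sum_u zeval (- t) (p (u * w0)%g) * zeval t (r u).
  by rewrite zeval_sum; apply: eq_bigr => u _; rewrite zevalM zeval_compN.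
have pairing_vinv : form (b c * Hs w0) c' = zeval vinv G.
  rewrite GE form_mul_longest c'E' mulr_suml (form_sumr formP).
  apply: eq_bigr => u _; rewrite -scalerAl d_Hstd_longest (form_scaler formP) mulrC.
  congr (_ * _); rewrite bcE (form_suml formP).
  rewrite -[RHS](sum_delta (fun z => zeval (- vinv) (p z))).
  by apply: eq_bigr => z _; rewrite (form_scalel formP) (form_Hstd formP).
have pairing_v : form (b c * Hs w0) c' = zeval v G.
  rewrite GE bcE' mulr_suml (form_suml formP) (reindex_inj (inv_inj w0K)).
  apply: eq_bigr => u _ /=.
  rewrite -scalerAl d_Hstd_longest w0K (form_scalel formP); congr (_ * _).
  rewrite c'E (form_sumr formP) -[RHS](sum_delta (fun z => zeval v (r z))).
  apply: eq_bigr => z _.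
  by rewrite (form_scaler formP) (form_Hstd formP) eq_sym.
have Gconst : G = (G`_0)%:P.
  by apply: zeval_bar_invariant; rewrite -pairing_v.
rewrite pairing_v Gconst zevalC -horner_coef0 /G horner_sum.
under eq_bigr do rewrite hornerM horner_comp !hornerE oppr0 !horner_coef0 p0 r0.
rewrite (bigD1 y) //= eqxx mulr1 big1 => [|u /negPf->]; last by rewrite mulr0.
by rewrite addr0 -(inj_eq (inv_inj w0K)) w0K eq_sym; case: eqP.
Qed.

End DualBases.

Theorem theorem4p2 (W : finGroupType) (S : {set W})
    (coxS : coxeter_system S)
    (w0 : W) (w0_longest : longest S w0)
    (H : algType laurent) (T : W -> H) (heckeT : hecke_algebra S T)
    (d : {rmorphism H -> H}) (dP : duality S T d)
    (b : {rmorphism H -> H}) (bP : b_involution S T b)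
    (form : H -> H -> laurent) (formP : standard_form S T form)
    (C : W -> H) (CP : forall x, kazhdan_lusztig S T d x (C x))
    (P : W -> H) (PP : forall x y, form (P x) (C y) = (x == y)%:R) :
  forall x : W, b (C x) * Hstd S T w0 = P (x * w0)%g.
Proof.
have w0w0 := longest_invol coxS heckeT formP w0_longest.
pose P' x := b (C (x * w0)%g) * Hstd S T w0.
have dualP' x y : form (P' x) (C y) = (x == y)%:R.
  rewrite (kazhdan_lusztig_pairing coxS heckeT dP bP formP w0_longest (CP _) (CP y)).
  by rewrite -mulgA w0w0 mulg1.
(* The shift by w0 in the index of P' makes it the family dual to C. *)
move=> x; rewrite (dual_family_unique heckeT formP PP dualP') /P'.
by rewrite -mulgA w0w0 mulg1.
Qed.
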